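(* Let $\mathcal{J}$ and $\mathcal{I}_n$ ($n\in\omega$) be ideals on $\omega$, and assume every $\mathcal{I}_n$ is analytic. Then $\sum^{\mathcal{J}}_{n\in\omega}\mathcal{I}_n$ is Egorov if and only if $\mathcal{J}$ is Egorov and $\{n\in\omega:\mathcal{I}_n\text{ is not Egorov}\}\in\mathcal{J}$.
   Context: An ideal on a countable set $S$ is a family $\mathcal{I}\subseteq\mathcal{P}(S)$ closed under finite unions and subsets, containing all finite subsets, with $S\notin\mathcal{I}$; analytic refers to $\mathcal{P}(\omega)\cong2^\omega$ with the product topology. For $M\subseteq\omega\times\omega$ and $n\in\omega$, $M_{(n)}=\{j:(n,j)\in M\}$, and $\sum^{\mathcal{J}}_{n\in\omega}\mathcal{I}_n=\{M\subseteq\omega\times\omega:\{n: M_{(n)}\notin\mathcal{I}_n\}\in\mathcal{J}\}$ (an ideal on $\omega\times\omega$). For an ideal $\mathcal{I}$ on $S$ and real functions $f_s,f$ on $Y$: $(f_s)$ is $\mathcal{I}$-pointwise convergent to $f$ if $\{s:|f_s(y)-f(y)|\ge\varepsilon\}\in\mathcal{I}$ for all $y,\varepsilon>0$, $\mathcal{I}$-uniformly convergent if $\{s:\exists y\,|f_s(y)-f(y)|\ge\varepsilon\}\in\mathcal{I}$ for all $\varepsilon>0$. $\mathcal{I}$ is Egorov if for every family $(f_s)_{s\in S}$ of Lebesgue measurable functions $[0,1]\to\mathbb{R}$ $\mathcal{I}$-pointwise convergent to a Lebesgue measurable $f$ and every $\eta>0$ there is a measurable $M\subseteq[0,1]$ with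 $\lambda([0,1]\setminus M)<\eta$ such that $(f_s\restriction M)$ is $\mathcal{I}$-uniformly convergent to $f\restriction M$. *)

(* Defs.v *)
From HB Require Import structures.
From mathcomp Require Import all_boot all_order all_algebra.
From mathcomp Require Import all_classical all_reals all_analysis.
Set Implicit Arguments.
Unset Strict Implicit.
Unset Printing Implicit Defensive.
Import Order.TTheory GRing.Theory Num.Theory.
Import numFieldNormedType.Exports.
Local Open Scope classical_set_scope.
Local Open Scope ring_scope.

Record ideal (S : countType) (I : set (set S)) : Prop := {
  ideal_setU : forall A B, I A -> I B -> I (A `|` B) ;
  ideal_sub : forall A B, A `<=` B -> I B -> I A ;
  ideal_finite : forall A, finite_set A -> I A ;
  ideal_proper : ~ I [set: S]
}.

Definition baire_space : topologicalType := prod_topology (fun _ : nat => nat).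

(* Intended for subsets of a Polish space [T]; the empty set is not an image of
   the Baire space and has to be added. *)
Definition analytic_set (T : topologicalType) (A : set T) : Prop :=
  A = set0 \/ exists2 f : baire_space -> T, continuous f & range f = A.

Definition set_of_cantor (x : cantor_space) : set nat := [set n | x n].

Definition analytic_family (I : set (set nat)) : Prop :=
  analytic_set (set_of_cantor @^-1` I).

(* [xsection M n] is [[set j | (n, j) \in M]]. *)
Definition ideal_sum (J : set (set nat)) (I : nat -> set (set nat)) :
    set (set (nat * nat)) :=
  [set M | J [set n | ~ I n (xsection M n)]].

Definition ideal_ptws_cvg (R : realType) (S : countType) (I : set (set S))
    (T : Type) (Y : set T) (f_ : S -> T -> R) (f : T -> R) : Prop :=
  forall y, Y y -> forall e : R, 0 < e -> I [set s | e <= `|f_ s y - f y|].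

Definition ideal_unif_cvg (R : realType) (S : countType) (I : set (set S))
    (T : Type) (Y : set T) (f_ : S -> T -> R) (f : T -> R) : Prop :=
  forall e : R, 0 < e -> I [set s | exists2 y, Y y & e <= `|f_ s y - f y|].

(* The real line with its Lebesgue (not Borel) measurable sets: this is the
   domain of [completed_lebesgue_measure], see
   [completed_caratheodory_measurable]. *)
Definition lebesgueTypeR (R : realType) :=
  caratheodory_type ((@wlength R idfun)^*)%mu.

Definition lebesgue_measurable (R : realType) (A : set R) : Prop :=
  measurable (A : set (lebesgueTypeR R)).

Definition lebesgue_measurable_fun (R : realType) (D : set R) (f : R -> R) :
    Prop :=
  measurable_fun (D : set (lebesgueTypeR R))
    (f : lebesgueTypeR R -> measurableTypeR R).

(* Functions on [0, 1] are given by total functions of which only the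
   restriction to [0, 1] is used. *)
Definition egorov (R : realType) (S : countType) (I : set (set S)) : Prop :=
  forall (f_ : S -> R -> R) (f : R -> R),
    (forall s, lebesgue_measurable_fun `[0, 1] (f_ s)) ->
    lebesgue_measurable_fun `[0, 1] f ->
    ideal_ptws_cvg I `[0, 1] f_ f ->
    forall eta : R, 0 < eta ->
    exists M : set R,
      [/\ lebesgue_measurable M, M `<=` `[0, 1],
          (completed_lebesgue_measure (`[0%R, 1%R] `\` M) < eta%:E)%E
        & ideal_unif_cvg I M f_ f].

(* Main.v *)
Require Import Defs.
From mathcomp Require Import all_boot all_order all_algebra.
From mathcomp Require Import all_classical all_reals all_analysis.
From mathcomp Require Import measurable_realfun ring lra.
Local Open Scope classical_set_scope.
Local Open Scope ring_scope.

Set Implicit Arguments.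
Unset Strict Implicit.
Unset Printing Implicit Defensive.
Import Order.TTheory GRing.Theory Num.Theory.

(* Egorov's property only concerns measurable sets: it says that whenever
   [{s | y \in B s}] is in [I] for all [y], almost all of [0, 1] is covered by a
   set [M] with [{s | M meets B s}] in [I].

   If [J] and J-almost all [I n] are Egorov, let [C n] be the set of [y] with
   [{j | y \in B (n, j)}] not in [I n], measurable because [I n] is analytic.
   Apply Egorov for [J] to the sets [C n], apply Egorov for [I n] to the sets
   [B (n, j) \ C n], and intersect the resulting sets.

   Conversely, the failure of Egorov for [I n] can be witnessed with the same
   constant 1/2 for all [n], so that a single application of Egorov for the sum
   handles all of them: exhausting [0, 1] by good sets leaves a set [N] of
   positive measure with only null good subsets, and an affine map blows up an
   interval in which [N] has density above 1/2. *)

(** * Prefixes, continuity and compactness in the Baire space *)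

Definition agree (X : Type) (n : nat) (z w : nat -> X) :=
  forall i, (i < n)%N -> z i = w i.

Lemma agreeS (X : Type) (n : nat) (z w : nat -> X) :
  agree n.+1 z w <-> agree n z w /\ z n = w n.
Proof.
split=> [h|[h e] i]; first by split=> [i ni|]; apply: h => //; exact: ltnW.
by rewrite ltnS leq_eqVlt => /predU1P[->//|/h].
Qed.

Lemma agree_le (X : Type) (m n : nat) (z w : nat -> X) :
  (m <= n)%N -> agree n z w -> agree m z w.
Proof. by move=> mn h i im; apply: h; exact: leq_trans mn. Qed.

Lemma baire_cvg (w : nat -> baire_space) (z : baire_space) :
  (forall n, agree n z (w n)) -> w @ \oo --> z.
Proof.
(* Each coordinate map is onto, so convergence can be tested on its images; there [w n i = z i] as
   soon as [n > i]. *)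
move=> zw; apply/cvg_sup => i; apply/cvg_image.
  by rewrite eqEsubset; split => // x _; exists (fun=> x : nat).
move=> A /= /nbhs_singleton Azi.
exists [set y : baire_space | A (y i)]; last first.
  by rewrite eqEsubset; split=> [_ [y Ay <-]//|x Ax]; exists (fun=> x : nat).
by exists i.+1 => // n /= ni; rewrite -(zw n i ni).
Qed.

(** If no prefix of [z] decided coordinate [m], counterexamples agreeing with [z] on longer and
    longer prefixes would converge to [z], while their images keep the wrong value at [m]. *)
Lemma baire_cantor_continuous (f : baire_space -> cantor_space) :
  continuous f -> forall z m, exists n, forall w, agree n z w ->
    agree m (f z) (f w).
Proof.
move=> cf z m; elim: m => [|m [n IH]]; first by exists 0%N.
suff [p pm] : exists p, forall w, agree p z w -> f z m = f w m.
  exists (maxn n p) => w zw; apply/agreeS; split.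
    by apply: IH; apply: agree_le zw; exact: leq_maxl.
  by apply: pm; apply: agree_le zw; exact: leq_maxr.
apply: contrapT => /forallNP no.
have {no}/choice[w zw] : forall p, exists w, agree p z w /\ f z m <> f w m.
  by move=> p; have /existsNP[w /not_implyP] := no p; exists w.
have fw : f (w n) @[n --> \oo] --> f z.
  by apply: (cvg_comp _ _ (baire_cvg (fun n => (zw n).1))); exact: cf.
have /(_ [set x | x m = f z m]) := fw.
case=> [|N _ /(_ N (leqnn _))/= /esym]; last exact: (zw N).2.
apply: (@proj_continuous _ (fun=> bool) m (f z) [set f z m]).
by rewrite nbhs_principalE; apply/principal_filterP.
Qed.

(** Course-of-values recursion: a rule for the next term given a finite prefix yields an infinite
    branch. *)
Lemma self_prefix_seq (g : seq nat -> nat) :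
  exists c : nat -> nat, forall n, c n = g (mkseq c n).
Proof.
pose s n := iter n (fun t => rcons t (g t)) [::].
exists (g \o s) => n; congr g.
by elim: n => //= n IH; rewrite mkseqS -IH.
Qed.

(** König's lemma: a prefix admitting approximations of every quality has a one-term extension that
    still does, because [b] leaves finitely many candidates. Continuity at the resulting branch
    gives the value [x]. *)
Lemma compact_image_closed (f : baire_space -> cantor_space) (b : nat -> nat)
    (x : cantor_space) : continuous f ->
  (forall k m, exists z, (forall i, (i < k)%N -> (z i <= b i)%N) /\
    agree m (f z) x) ->
  exists z, f z = x.
Proof.
move=> cf fx.
pose Q s := forall k m, exists z : baire_space,
  [/\ forall i, (i < k)%N -> (z i <= b i)%N, agree (size s) (nth 0%N s) z &
      agree m (f z) x].
have Q0 : Q [::] by move=> k m; have [z [? ?]] := fx k m; exists z.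
have QS s : exists v, Q s -> Q (rcons s v).
  have [Qs|nQs] := pselect (Q s); last by exists 0%N.
  apply: contrapT => /forallNP no.
  have {no}/choice[u uP] : forall v, exists km : nat * nat, ~ exists z : baire_space,
      [/\ forall i, (i < km.1)%N -> (z i <= b i)%N,
          agree (size (rcons s v)) (nth 0%N (rcons s v)) z &
          agree km.2 (f z) x].
    move=> v; have /not_implyP[_ /existsNP[k /existsNP[m km]]] := no v.
    by exists (k, m).
  (* A [z] that meets the bounds [u v] of all candidates at once refutes the failure of its own
     value; [(size s).+1] ensures that [z (size s)] is a candidate. *)
  pose K := maxn (size s).+1 (\max_(v < (b (size s)).+1) (u v).1).
  pose M := \max_(v < (b (size s)).+1) (u v).2.
  have [z [zb zs zx]] := Qs K M.
  have zB : (z (size s) < (b (size s)).+1)%N by rewrite ltnS zb// leq_max leqnn.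
  apply: (uP (z (size s))); exists z; split.
  - move=> i iu; apply: zb; apply: leq_trans iu _.
    by rewrite leq_max (leq_bigmax (Ordinal zB)) orbT.
  - rewrite size_rcons; apply/agreeS; split; last by rewrite nth_rcons ltnn eqxx.
    by move=> i si; rewrite nth_rcons si; exact: zs.
  - exact: agree_le (leq_bigmax (Ordinal zB)) zx.
have /choice[g gP] := QS.
have [c cE] := self_prefix_seq g.
have Qc n : Q (mkseq c n).
  by elim: n => // n IH; rewrite mkseqS cE; exact: gP.
exists c; apply/funext => i.
have [n nP] := baire_cantor_continuous cf c i.+1.
have [z [_ cz zx]] := Qc n 0%N i.+1.
rewrite -(zx i)//; apply: nP => // j jn.
by rewrite -cz ?size_mkseq// nth_mkseq.
Qed.

(** * Measurable hulls and universal measurability of analytic sets *)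

(** Intersect measurable supersets whose measures come within [1 / (k + 1)] of the infimum; if the
    infimum is infinite, the whole space serves. *)
Lemma measure_hull d (T : measurableType d) (R : realType)
    (mu : {measure set T -> \bar R}) (A : set T) :
  exists H, [/\ measurable H, A `<=` H &
    forall G, measurable G -> A `<=` G -> (mu H <= mu G)%E].
Proof.
pose S := [set mu H | H in [set H | measurable H /\ A `<=` H]].
have S0 : lbound S 0%E by move=> _ [H _ <-].
have [Soo|Sfin] := eqVneq (ereal_inf S) +oo%E.
  exists setT; split => // G mG AG.
  suff -> : mu G = +oo%E by rewrite leey.
  apply/eqP; rewrite -leye_eq -Soo.
  by apply: ereal_inf_lbound; exists G.
have {}Sfin : ereal_inf S \is a fin_num.
  by rewrite ge0_fin_numE ?lt_neqAle ?Sfin ?leey//; exact: le_ereal_inf_tmp.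
have /choice[H HP] : forall k : nat, exists H, [/\ measurable H, A `<=` H &
    (mu H < ereal_inf S + k.+1%:R^-1%:E)%E].
  move=> k; have k0 : (0 < k.+1%:R^-1 :> R)%R by rewrite invr_gt0.
  by have [_ [H [mH AH] <-] Hk] := lb_ereal_inf_adherent k0 Sfin; exists H.
exists (\bigcap_k H k); split.
- by apply: bigcapT_measurable => k; have [] := HP k.
- by move=> t At k _; have [_ AH _] := HP k; exact: AH.
move=> G mG AG; apply: (@le_trans _ _ (ereal_inf S)); last first.
  by apply: ereal_inf_lbound; exists G.
apply/lee_addgt0Pr => _/posnumP[e]; near \oo => k.
have [mH _ /ltW Hk] := HP k.
apply: (@le_trans _ _ (mu (H k))).
  apply: le_measure; rewrite ?inE//; last exact: bigcap_inf.
  by apply: bigcapT_measurable => i; have [] := HP i.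
apply: (le_trans Hk); rewrite leeD2l// lee_fin; apply: ltW.
by near: k; exact: near_infty_natSinv_lt.
Unshelve. all: by end_near. Qed.

(* Arbitrary sets have continuity from below for the outer measure [mu \o h]. *)
Lemma hull_nondecreasing d (T : measurableType d) (R : realType)
    (mu : {measure set T -> \bar R}) (h : set T -> set T) (A : nat -> set T)
    (e : R) :
  (forall X, [/\ measurable (h X), X `<=` h X &
    forall G, measurable G -> X `<=` G -> (mu (h X) <= mu G)%E]) ->
  {homo A : m n / (m <= n)%N >-> m `<=` n} ->
  (mu (h (\bigcup_n A n)) < +oo)%E -> (0 < e)%R ->
  exists n, (mu (h (\bigcup_n A n)) <= mu (h (A n)) + e%:E)%E.
Proof.
move=> hP ndA Aoo e0; apply: contrapT => /forallNP no.
set X := \bigcup_n A n in Aoo no.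
have mh Y : measurable (h Y) by have [] := hP Y.
have hXfin : mu (h X) \is a fin_num by rewrite ge0_fin_numE.
(* The hulls themselves need not increase with [n], but the intersections of their tails do, and
   [H n] still lies between [A n] and [h (A n)]. *)
pose H n := \bigcap_(i in [set i | (n <= i)%N]) h (A i).
have mH n : measurable (H n) by apply: bigcap_measurable; [exists n => /=|].
have ndH : nondecreasing_seq H.
  move=> m n mn; apply/subsetPset => t Ht i /= ni.
  by apply: Ht => /=; exact: leq_trans ni.
have cvgH := nondecreasing_cvg_mu (mu := mu) mH (bigcupT_measurable _ mH) ndH.
have XH : (mu (h X) <= mu (\bigcup_n H n))%E.
  have [_ _] := hP X; apply; first exact: bigcupT_measurable.
  move=> t [n _ Ant]; exists n => // i /= ni.
  by have [_ + _] := hP (A i); apply; exact: ndA Ant.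
(* If no [n] worked, every [H n] would fall short of [h X] by [e], hence so would their union,
   although it contains [X]. *)
have : (mu (\bigcup_n H n) <= mu (h X) - e%:E)%E.
  rewrite -(cvg_lim _ cvgH)//; apply: lime_le; first by apply/cvg_ex; eexists; exact: cvgH.
  near=> n; rewrite leeBrDr//.
  have /negP := no n; rewrite -ltNge => /ltW; apply: le_trans.
  rewrite leeD2r//; apply: le_measure; rewrite ?inE//.
  by move=> t; apply => /=.
apply/negP; rewrite -ltNge; apply: lt_le_trans XH.
by rewrite lteBlDr// lteDl ?lte_fin.
Unshelve. all: by end_near. Qed.

Lemma measurable_agree d (T : measurableType d) (B : nat -> set T) (m : nat)
    (w : nat -> bool) : (forall j, measurable (B j)) ->
  measurable [set t | agree m w (fun j => `[< B j t >])].
Proof.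
move=> mB; elim: m => [|m IH]; first by rewrite (_ : mkset _ = setT)//;
  apply/seteqP; split.
rewrite (_ : mkset _ = [set t | agree m w (fun j => `[< B j t >])] `&`
    (if w m then B m else ~` B m)); last first.
  apply/seteqP; split=> t /=.
    move=> /agreeS[h wm]; split => //.
    by case: (w m) wm => /esym/asboolP.
  move=> [h wm]; apply/agreeS; split => //.
  by case: (w m) wm => Bt; apply/esym; [apply/asboolP|apply/asboolPn].
by apply: measurableI => //; case: (w m) => //; exact: measurableC.
Qed.

(* Analytic sets are universally measurable.  Choosing a bound [c k] on the
   [k]-th coordinate costs at most [e / 2 ^ k.+1] of outer measure, and the
   points left lie in the image of a compact set. *)
Lemma measurable_analytic d (T : measurableType d) (R : realType)
    (mu : {measure set T -> \bar R}) (D : set T) (B : nat -> set T)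
    (f : baire_space -> cantor_space) :
  measure_is_complete mu -> measurable D -> (mu D < +oo)%E ->
  (forall j, measurable (B j)) -> continuous f ->
  measurable (D `&` [set t | range f (fun j => `[< B j t >])]).
Proof.
move=> cmu mD Doo mB cf.
pose x t : cantor_space := fun j => `[< B j t >].
(* [E s] bounds only the first [size s] coordinates of a preimage, so [E [::]] is the set in
   question and raising the next bound exhausts [E s]. *)
pose E (s : seq nat) := D `&` [set t | exists z : baire_space,
  (forall i, (i < size s)%N -> (z i <= nth 0%N s i)%N) /\ f z = x t].
have E0E : D `&` [set t | range f (fun j => `[< B j t >])] = E [::].
  apply/seteqP; split=> t [Dt]; first by move=> [z _ fz]; split => //; exists z.
  by move=> [z [_ fz]]; split => //; exists z.
have {}ED s : E s `<=` D by move=> t [].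
have EU s : E s = \bigcup_n E (rcons s n).
  apply/seteqP; split=> [t [Dt [z [zs fz]]]|t [n _ [Dt [z [zs fz]]]]].
    exists (z (size s)) => //; split => //; exists z; split => // i.
    rewrite size_rcons ltnS nth_rcons leq_eqVlt => /predU1P[->|si].
      by rewrite ltnn eqxx.
    by rewrite si; exact: zs.
  split => //; exists z; split => // i si.
  have := zs i; rewrite size_rcons nth_rcons si; apply.
  exact: ltnW.
have Eh s : {homo (fun n => E (rcons s n)) : m n / (m <= n)%N >-> m `<=` n}.
  move=> m n mn t [Dt [z [zs fz]]]; split => //; exists z; split => // i si.
  apply: (leq_trans (zs i _)); first by rewrite !size_rcons in si *.
  by rewrite !nth_rcons; case: ifP => // _; case: ifP.
have /choice[h hP] := measure_hull mu.
have mh X : measurable (h X) by have [] := hP X.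
have hoo s : (mu (h (E s)) < +oo)%E.
  by apply: le_lt_trans Doo; have [_ _] := hP (E s); apply.
have approx (e : R) : 0 < e -> exists C,
    [/\ measurable C, C `<=` E [::] & (mu (h (E [::])) <= mu C + e%:E)%E].
  move=> e0.
  have /choice[g gP] : forall s, exists v, (mu (h (E s)) <=
      mu (h (E (rcons s v))) + (e / 2 ^+ (size s).+1)%:E)%E.
    move=> s.
    have := @hull_nondecreasing _ _ _ mu h _ (e / 2 ^+ (size s).+1) hP (Eh s).
    rewrite -EU; apply; first exact: hoo.
    by rewrite divr_gt0// exprn_gt0.
  have [c cE] := self_prefix_seq g.
  (* [e - e / 2 ^+ n] is the sum of the losses [e / 2 ^+ i.+1] over [i < n]. *)
  have hE n : (mu (h (E [::])) <=
      mu (h (E (mkseq c n))) + (e - e / 2 ^+ n)%:E)%E.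
    elim: n => [|n IH]; first by rewrite expr0 divr1 subrr adde0.
    apply: (le_trans IH); rewrite mkseqS cE.
    apply: (le_trans (leeD2r _ (gP _))).
    rewrite size_mkseq -addeA leeD2l// -EFinD lee_fin exprS invfM.
    have : 0 <= (2 ^+ n)^-1 :> R by rewrite invr_ge0 exprn_ge0.
    lra.
  (* [F k] weakens [f z = x t] to agreement on each finite prefix. This involves only countably many
     words, hence is measurable; on the intersection of all [F k], compactness restores a true
     preimage. *)
  pose F k := D `&` [set t | forall m, exists z : baire_space,
    (forall i, (i < k)%N -> (z i <= c i)%N) /\ agree m (f z) (x t)].
  have EF k : E (mkseq c k) `<=` F k.
    move=> t [Dt [z [zc fz]]]; split => // m; exists z.
    split=> [i ik|i _]; last by rewrite fz.
    by have := zc i; rewrite size_mkseq nth_mkseq//; exact.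
  have mF k : measurable (F k).
    pose G m (w : seq bool) := [set t | agree m (nth false w) (x t) /\
      exists z : baire_space, (forall i, (i < k)%N -> (z i <= c i)%N) /\
        agree m (f z) (nth false w)].
    rewrite (_ : F k = D `&` \bigcap_m \bigcup_w G m w).
      apply: measurableI => //; apply: bigcapT_measurable => m.
      apply: countable_bigcupT_measurable => // w.
      have [zw|nzw] := pselect (exists z : baire_space,
          (forall i, (i < k)%N -> (z i <= c i)%N) /\
          agree m (f z) (nth false w)).
        rewrite (_ : G m w = [set t | agree m (nth false w) (x t)]).
          exact: measurable_agree.
        by apply/seteqP; split=> [t []|t].
      by rewrite (_ : G m w = set0)//; apply/seteqP; split => // t [].
    congr (D `&` _); apply/seteqP; split=> [t tF m _|t tG m].
      have [z [zc fz]] := tF m.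
      exists (mkseq (f z) m) => //; split.
        by move=> i im; rewrite nth_mkseq//; exact: fz.
      by exists z; split => // i im; rewrite nth_mkseq.
    have [w _ [wx [z [zc zw]]]] := tG m I.
    by exists z; split => // i im; rewrite zw// wx.
  have ndF : nonincreasing_seq F.
    move=> k l kl; apply/subsetPset => t [Dt tF]; split => // m.
    have [z [zc fz]] := tF m; exists z; split => // i ik.
    by apply: zc; exact: leq_trans kl.
  have F0oo : (mu (F 0%N) < +oo)%E.
    by apply: le_lt_trans Doo; apply: le_measure; rewrite ?inE// => t [].
  have cvgF := nonincreasing_cvg_mu F0oo mF (bigcapT_measurable mF) ndF.
  exists (\bigcap_k F k); split; first exact: bigcapT_measurable.
    move=> t tF; have [Dt _] := tF 0%N I; split => //.
    have [|z fz] := @compact_image_closed f c (x t) cf; last by exists z.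
    by move=> k m; have [_ /(_ m)] := tF k I.
  rewrite -leeBlDr// -(cvg_lim _ cvgF)//; apply: lime_ge.
    by apply/cvg_ex; eexists; exact: cvgF.
  near=> n; rewrite leeBlDr//; apply: (le_trans (hE n)); apply: leeD.
    by have [_ _] := hP (E (mkseq c n)); apply.
  by rewrite lee_fin gerBl divr_ge0// ?exprn_ge0// ltW.
have /choice[C CP] : forall k : nat, exists C, [/\ measurable C, C `<=` E [::] &
    (mu (h (E [::])) <= mu C + k.+1%:R^-1%:E)%E].
  by move=> k; apply: approx; rewrite invr_gt0.
have mC : measurable (\bigcup_k C k).
  by apply: bigcupT_measurable => k; have [] := CP k.
have CE : \bigcup_k C k `<=` E [::].
  by move=> t [k _]; have [_ + _] := CP k; exact.
have Eh0 : E [::] `<=` h (E [::]) by have [] := hP (E [::]).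
rewrite E0E (_ : E [::] = \bigcup_k C k `|` (E [::] `\` \bigcup_k C k)); last first.
  by rewrite setDUK.
apply: measurableU => //; apply: cmu.
(* The inner approximations [C k] exhaust the measure of the hull, so the rest of [E [::]] lies in a
   null set and completeness applies. *)
exists (h (E [::]) `\` \bigcup_k C k); split.
- exact: measurableD.
- rewrite measureD ?hoo// setIidr; last exact: subset_trans Eh0.
  have Cfin : mu (\bigcup_k C k) \is a fin_num.
    rewrite ge0_fin_numE//; apply: le_lt_trans (hoo [::]); apply: le_measure; rewrite ?inE//.
    exact: subset_trans Eh0.
  apply/eqP; rewrite eq_le; apply/andP; split; last first.
    rewrite sube_ge0 ?Cfin//; apply: le_measure; rewrite ?inE//.
    exact: subset_trans Eh0.
  rewrite leeBlDr// add0e; apply/lee_addgt0Pr => _/posnumP[e]; near \oo => k.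
  have [mCk _ Ck] := CP k; apply: (le_trans Ck); apply: leeD.
    by apply: le_measure; rewrite ?inE//; exact: bigcup_sup.
  rewrite lee_fin; apply: ltW.
  by near: k; exact: near_infty_natSinv_lt.
- exact: setSD.
Unshelve. all: by end_near. Qed.

(** * Egorov's property for measurable sets *)

Lemma completed_lebesgue_measure01 (R : realType) :
  completed_lebesgue_measure (`[0%R, 1%R] : set R) = 1%E :> \bar R.
Proof.
rewrite [LHS](_ : _ = lebesgue_measure (`[0%R, 1%R] : set R))//.
by rewrite lebesgue_measure_itv/= lte_fin ltr01 oppr0 adde0.
Qed.

Lemma lebesgue_measurable01 (R : realType) :
  measurable (`[0%R, 1%R] : set (lebesgueTypeR R)).
Proof. exact: sub_caratheodory (measurable_itv _). Qed.
Arguments lebesgue_measurable01 : clear implicits.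

Definition egorov_sets (R : realType) (S : countType) (I : set (set S)) :=
  forall B : S -> set (lebesgueTypeR R),
    (forall s, measurable (B s)) ->
    (forall y, `[0%R, 1%R]%classic y -> I [set s | B s y]) ->
    forall eta : R, 0 < eta ->
    exists M : set (lebesgueTypeR R),
      [/\ measurable M, M `<=` `[0, 1],
          (completed_lebesgue_measure (`[0%R, 1%R] `\` M) < eta%:E)%E
        & I [set s | exists2 y, M y & B s y]].

(** Serves to apply Egorov countably often: the [k]-th application may lose [eta / 2 ^ (k + 2)], and
    the total [eta / 2] keeps the final inequality strict. *)
Lemma cosmall_bigcap (R : realType) (P : nat -> set (lebesgueTypeR R) -> Prop) :
  (forall k (eta : R), 0 < eta -> exists M : set (lebesgueTypeR R),
    [/\ measurable M, M `<=` `[0, 1],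
        (completed_lebesgue_measure (`[0%R, 1%R] `\` M) < eta%:E)%E & P k M]) ->
  forall eta : R, 0 < eta -> exists M : nat -> set (lebesgueTypeR R),
    [/\ measurable (\bigcap_k M k), \bigcap_k M k `<=` `[0, 1],
        (completed_lebesgue_measure (`[0%R, 1%R] `\` \bigcap_k M k) < eta%:E)%E
      & forall k, P k (M k)].
Proof.
move=> H eta eta0.
have /choice[M MP] : forall k, exists M : set (lebesgueTypeR R),
    [/\ measurable M, M `<=` `[0, 1],
        (completed_lebesgue_measure (`[0%R, 1%R] `\` M) <
          (eta / 2 / (2 ^ k.+1)%:R)%:E)%E & P k M].
  by move=> k; apply: H; rewrite !divr_gt0// ltr0n expn_gt0.
have mM k : measurable (M k) by have [] := MP k.
exists M; split; last by move=> k; have [] := MP k.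
- exact: bigcapT_measurable.
- by move=> t Mt; have [_ + _ _] := MP 0%N; apply; exact: Mt.
have mD (A : set (lebesgueTypeR R)) : measurable A ->
    measurable (`[0%R, 1%R] `\` A : set (lebesgueTypeR R)).
  by apply: measurableD; exact: lebesgue_measurable01.
have /le_lt_trans : (completed_lebesgue_measure (`[0%R, 1%R] `\` \bigcap_k M k)
    <= (eta / 2)%:E)%E; last first.
  by apply; rewrite lte_fin gtr_pMr// invf_lt1// ltr1n.
apply: (@le_trans _ _ (\sum_(k <oo)
    completed_lebesgue_measure (`[0%R, 1%R] `\` M k))%E).
  apply: measure_sigma_subadditive => [k||]; first exact: mD.
    by apply: mD; exact: bigcapT_measurable.
  by rewrite setDE setC_bigcap setI_bigcupr => t [k _ ?]; exists k.
have eta20 : 0 <= eta / 2 by rewrite ltW// divr_gt0.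
have := @epsilon_trick R (fun=> 0%E) (eta / 2) xpredT (fun=> lexx _) eta20.
rewrite [X in (_ <= X + _)%E]eseries0// add0e; apply: le_trans.
apply: lee_nneseries => // k _; rewrite add0e.
by have [_ _ /ltW] := MP k.
Qed.

(** Indicator functions give one direction. For the other, use the sets where [f_ s] and [f] differ
    by at least [1 / (k + 1)], and intersect over [k]. *)
Lemma egorovP (R : realType) (S : countType) (I : set (set S)) :
  (forall A B, A `<=` B -> I B -> I A) -> egorov R I <-> egorov_sets R I.
Proof.
move=> Isub; split=> [eI B mB IB eta eta0|eI f_ f mf_ mf cvgf eta eta0].
  have [||y y01 e e0|M [mM M01 etaM unif]] :=
      eI (fun s => \1_(B s)) (cst 0) _ _ _ eta eta0.
  - by move=> s; exact: measurable_indic.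
  - exact: measurable_cst.
  - apply: Isub (IB y y01) => s /=; rewrite subr0 indicE.
    case: (boolP (y \in B s)) => [|_]; first by rewrite inE.
    by rewrite normr0 leNgt e0.
  exists M; split => //; apply: Isub (unif 1 ltr01) => s [y My Bsy].
  by exists y => //=; rewrite subr0 indicE mem_set// normr1.
have mB k s : measurable ([set y | `[0, 1]%classic y /\
    k.+1%:R^-1 <= `|f_ s y - f y|] : set (lebesgueTypeR R)).
  have := measurableT_comp (@normr_measurable R setT)
    (measurable_funB (mf_ s) mf).
  move=> /(_ (lebesgue_measurable01 _) `[k.+1%:R^-1, +oo[%classic).
  move=> /(_ (measurable_itv _)); congr measurable.
  by apply/seteqP; split=> y /=; rewrite !in_itv/= andbT.
have [//|M [mM M01 etaM MP]] := @cosmall_bigcap R (fun k M =>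
    I [set s | exists2 y, M y & `[0, 1]%classic y /\
      k.+1%:R^-1 <= `|f_ s y - f y|]) _ eta eta0.
  move=> k; apply: eI => [s|y y01]; first exact: mB.
  have := cvgf y y01 k.+1%:R^-1; rewrite invr_gt0 => /(_ (ltr0Sn _ _)).
  by apply: Isub => s [].
exists (\bigcap_k M k); split => // e e0.
near \oo => k; apply: Isub (MP k) => s [y My fy]; exists y; first exact: My.
split; first exact: M01.
apply: le_trans fy; apply: ltW; near: k; exact: (near_infty_natSinv_lt (PosNum e0)).
Unshelve. all: by end_near. Qed.

(** * Affine maps, density and witnesses for the failure of Egorov's property *)

(** A cover of [A] by half-open intervals pulls back to a cover by half-open intervals whose lengths
    are divided by [c]. *)
Lemma le_outer_measure_affine (R : realType) (c d : R) (A : set R) : 0 < c ->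
  (completed_lebesgue_measure ((fun x => c * x + d)%R @^-1` A) <=
    c^-1%:E * completed_lebesgue_measure A)%E.
Proof.
move=> c0; rewrite -lee_pdivrMl ?invr_gt0// invrK.
apply: le_ereal_inf_tmp => _ [F [mF AF] <-].
rewrite -lee_pdivlMl//.
apply: (@le_trans _ _ (\sum_(k <oo) completed_lebesgue_measure
    ((fun x => c * x + d)%R @^-1` F k))%E).
  apply: (le_trans (le_outer_measure _ _ _ (preimage_subset AF))).
  rewrite preimage_bigcup; exact: outer_measure_sigma_subadditive.
rewrite -nneseriesZl//.
apply: lee_nneseries => // k _.
have [[x y] _ <-] := mF k.
rewrite (_ : _ @^-1` _ = `](x - d) / c, (y - d) / c]%classic); last first.
  by apply/seteqP; split=> t /=;
    rewrite !in_itv/= ltr_pdivrMr// ler_pdivlMr// ltrBlDr lerBrDr (mulrC t).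
rewrite [leLHS](_ : _ = wlength idfun `](x - d) / c, (y - d) / c]%classic); last first.
  apply: (@measurable_mu_extE _ R (ocitv_type R) (wlength idfun)).
  exact: is_ocitv.
rewrite /= !wlength_itv/= !lte_fin ltr_pM2r ?invr_gt0// ltrD2r.
case: ifP => _; last by rewrite mule0.
by rewrite -!EFinD -EFinM lee_fin -mulrBl mulrC; lra.
Qed.


(** The reverse inequality is the previous lemma for the inverse map. *)
Lemma outer_measure_affine (R : realType) (c d : R) (A : set R) : 0 < c ->
  (completed_lebesgue_measure ((fun x => c * x + d)%R @^-1` A) =
    c^-1%:E * completed_lebesgue_measure A)%E.
Proof.
move=> c0; apply/eqP; rewrite eq_le le_outer_measure_affine//=.
rewrite lee_pdivrMl//.
have ci0 : 0 < c^-1 by rewrite invr_gt0.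
have := le_outer_measure_affine (- d / c) ((fun x => c * x + d)%R @^-1` A) ci0.
rewrite invrK; congr (completed_lebesgue_measure _ <= _)%E.
apply/seteqP; split=> x /=; rewrite mulrDr mulrA divff ?gt_eqF// mul1r mulrCA
  divff ?gt_eqF// mulr1 subrK//.
Qed.

(** Carathéodory's criterion for [A] transfers because the inverse map carries test sets over and
    merely scales their outer measures. *)
Lemma measurable_affine (R : realType) (c d : R) (A : set (lebesgueTypeR R)) :
  0 < c -> measurable A ->
  measurable ((fun x : R => c * x + d) @^-1` A : set (lebesgueTypeR R)).
Proof.
move=> c0 mA.
have {}mA : caratheodory_measurable (@completed_lebesgue_measure R) A := mA.
suff : caratheodory_measurable (@completed_lebesgue_measure R)
    ((fun x : R => c * x + d) @^-1` A) by [].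
have cX (B : set R) : completed_lebesgue_measure B =
    (c^-1%:E * completed_lebesgue_measure ((fun x => c^-1 * x + - d / c)%R @^-1` B))%E.
  rewrite outer_measure_affine ?invr_gt0// invrK muleA -EFinM mulVf ?gt_eqF//.
  by rewrite mul1e.
move=> X; rewrite (cX X) [X in _ = (X + _)%E]cX [X in _ = (_ + X)%E]cX.
rewrite -ge0_muleDr; [|exact: outer_measure_ge0|exact: outer_measure_ge0].
congr (_ * _)%E.
have cK (x : R) : c * (c^-1 * x + - d / c) + d = x.
  by rewrite mulrDr mulrA divff ?gt_eqF// mul1r mulrCA divff ?gt_eqF// mulr1 subrK.
rewrite [LHS](mA _); congr (completed_lebesgue_measure _ + completed_lebesgue_measure _)%E.
  by apply/seteqP; split=> x /=; rewrite cK.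
by apply/seteqP; split=> x /=; rewrite cK.
Qed.

(** A weak form of Lebesgue density: if intervals of total length below twice the measure of [N]
    cover [N], they cannot all be at most half filled by it. *)
Lemma dense_interval (R : realType) (N : set (lebesgueTypeR R)) :
  measurable N -> (0 < completed_lebesgue_measure N < +oo)%E ->
  exists a b : R, a < b /\
    (((b - a) / 2)%:E < completed_lebesgue_measure (N `&` `]a, b]))%E.
Proof.
move=> mN /andP[N0 Noo]; apply: contrapT => no.
have Nfin : completed_lebesgue_measure N \is a fin_num by rewrite ge0_fin_numE.
have r0 : 0 < fine (completed_lebesgue_measure N).
  by rewrite fine_gt0// N0 Noo.
have [_ [F [mF NF] <-]] := lb_ereal_inf_adherent r0 Nfin.
rewrite fineK// => FN'.
have {FN'}FN : (\sum_(k <oo) wlength idfun (F k) <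
    completed_lebesgue_measure N + completed_lebesgue_measure N)%E := FN'.
have half k : (completed_lebesgue_measure (N `&` F k) <= 2^-1%:E * wlength idfun (F k))%E.
  have [[x y] _ <-] := mF k.
  have [xy|yx] := ltP x y.
    rewrite wlength_itv/= lte_fin xy -EFinD -EFinM mulrC leNgt.
    by apply/negP => h; apply: no; exists x, y.
  rewrite (set_itv_ge (_ : ~~ (BRight x < BRight y)%O)); last by rewrite bnd_simp -leNgt.
  by rewrite setI0 measure0 mule_ge0// wlength_ge0.
have : (completed_lebesgue_measure N < completed_lebesgue_measure N)%E; last by rewrite ltxx.
apply: (@le_lt_trans _ _ (2^-1%:E * \sum_(k <oo) wlength idfun (F k))%E).
  rewrite -nneseriesZl//.
  apply: (@le_trans _ _ (\sum_(k <oo) completed_lebesgue_measure (N `&` F k))%E); last first.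
    by apply: lee_nneseries.
  apply: (le_trans _ (outer_measure_sigma_subadditive _ _)).
  by apply: le_outer_measure; rewrite -setI_bigcupr => t Nt; split => //; exact: NF.
rewrite lte_pdivrMl//; apply: (lt_le_trans FN).
by rewrite -(fineK Nfin) -EFinD -EFinM lee_fin mulr_natl mulr2n.
Qed.

(* [N] is the complement of the union of a sequence of good sets (sets [M] with
   [{s | M meets B s}] in [I]) whose measures approach their supremum. *)
Lemma not_egorov_sets_null (R : realType) (S : countType) (I : set (set S)) :
  ideal I -> ~ egorov R I ->
  exists2 B : S -> set (lebesgueTypeR R),
    (forall s, measurable (B s)) /\
    (forall y, `[0%R, 1%R]%classic y -> I [set s | B s y]) &
    exists N : set (lebesgueTypeR R),
      [/\ measurable N, N `<=` `[0, 1],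
          (0 < completed_lebesgue_measure N)%E &
          forall P, measurable P -> P `<=` N ->
            I [set s | exists2 y, P y & B s y] ->
            completed_lebesgue_measure P = 0%E].
Proof.
move=> [IU Isub Ifin _]; rewrite (egorovP R Isub).
move=> /existsNP[B /not_implyP[mB /not_implyP[IB]]].
move=> /existsNP[eta /not_implyP[eta0 noM]].
exists B => //.
pose good (M : set (lebesgueTypeR R)) := [/\ measurable M, M `<=` `[0, 1] &
  I [set s | exists2 y, M y & B s y]].
have goodU M M' : good M -> good M' -> good (M `|` M').
  move=> [mM M01 IM] [mM' M'01 IM']; split.
  - exact: measurableU.
  - by move=> t [/M01|/M'01].
  - apply: Isub (IU _ _ IM IM') => s [y [My|M'y] By].
      by left; exists y.
    by right; exists y.
have good0 : good set0.
  split=> //; apply: Isub (Ifin _ (finite_set0 S)) => s [y].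
  by [].
pose sup := ereal_sup [set completed_lebesgue_measure M | M in good].
have supfin : sup \is a fin_num.
  rewrite ge0_fin_numE; last first.
    by apply: ereal_sup_ubound; exists set0 => //; rewrite measure0.
  apply: (@le_lt_trans _ _ 1%E); last exact: ltry.
  apply: ge_ereal_sup => _ [M [mM M01 _] <-].
  by rewrite -(completed_lebesgue_measure01 R); apply: le_outer_measure.
have /choice[M MP] : forall k : nat, exists M, good M /\
    (sup - k.+1%:R^-1%:E < completed_lebesgue_measure M)%E.
  move=> k; have k0 : (0 < k.+1%:R^-1 :> R)%R by rewrite invr_gt0.
  by have [_ [M gM <-] Hk] := ub_ereal_sup_adherent k0 supfin; exists M.
have mM k : measurable (M k) by have [[]] := MP k.
have m01 := lebesgue_measurable01 R.
pose G n : set (lebesgueTypeR R) := `[0%R, 1%R]%classic `\` \big[setU/set0]_(i < n) M i.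
have gU n : good (\big[setU/set0]_(i < n) M i).
  by elim/big_ind: _ => // i _; have [] := MP i.
have mG n : measurable (G n) by apply: measurableD => //; have [] := gU n.
exists (\bigcap_n G n); split.
- exact: bigcapT_measurable.
- by move=> t /(_ 0%N Logic.I)[].
(* If [N] were null, some finite union of the [M i] would be a good set missing less than [eta] of
   the unit interval, against the choice of [eta]. *)
- rewrite lt_neqAle outer_measure_ge0 andbT eq_sym; apply/eqP => N0.
  have ndG : nonincreasing_seq G.
    move=> m n mn; apply/subsetPset; apply: setDS.
    exact: subset_bigsetU.
  have G0oo : (completed_lebesgue_measure (G 0%N) < +oo)%E.
    apply: (@le_lt_trans _ _ 1%E); last exact: ltry.
    by rewrite -(completed_lebesgue_measure01 R); apply: le_outer_measure => t [].
  have := nonincreasing_cvg_mu (mu := @completed_lebesgue_measure R) G0oo mG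
    (bigcapT_measurable mG) ndG.
  rewrite [X in _ --> X]N0 => cvgG.
  have : \forall n \near \oo, (completed_lebesgue_measure (G n) < eta%:E)%E.
    by apply: (cvgG [set x | (x < eta%:E)%E]); apply: open_ereal_lt'; rewrite lte_fin.
  move=> [n _ /(_ n (leqnn _)) /= Gn]; apply: noM.
  by exists (\big[setU/set0]_(i < n) M i); have [? ? ?] := gU n; split.
move=> P mP PN IP; apply/eqP; rewrite eq_le outer_measure_ge0 andbT.
apply/lee_addgt0Pr => _/posnumP[e]; rewrite add0e; near \oo => k.
(* [G k.+1] already omits [M k]. So [P] is disjoint from [M k], and their union, being good, forces
   the measure of [P] below [1 / (k + 1)]. *)
have PM : M k `&` P = set0.
  apply/seteqP; split => // t [Mt /PN /(_ k.+1 Logic.I)[_]]; apply.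
  by rewrite big_ord_recr; right.
have gP : good P by split => // t /PN/(_ 0%N Logic.I)[].
have : (completed_lebesgue_measure (M k `|` P) <= sup)%E.
  by apply: ereal_sup_ubound; exists (M k `|` P) => //; apply: goodU => //; have [] := MP k.
rewrite measureU//.
have [_ /ltW Mk] := MP k.
move=> /(le_trans (leeD2r _ Mk)).
rewrite -addeA -[leRHS]adde0 leeD2lE// addeC leeBlDr// add0e => /le_trans; apply.
rewrite lee_fin ltW//; near: k; exact: near_infty_natSinv_lt.
Unshelve. all: by end_near. Qed.

(** Makes the constant independent of the ideal. A set [M] missing less than 1/2 meets the blow-up
    of [N] in positive measure; if it were good, that part, mapped back, would be a good and hence
    null subset of [N]. *)
Lemma not_egorov_half (R : realType) (S : countType) (I : set (set S)) :
  ideal I -> ~ egorov R I ->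
  exists B : S -> set (lebesgueTypeR R),
    [/\ forall s, measurable (B s),
        forall y, `[0%R, 1%R]%classic y -> I [set s | B s y] &
        forall M : set (lebesgueTypeR R), measurable M -> M `<=` `[0, 1] ->
          (completed_lebesgue_measure (`[0%R, 1%R] `\` M) < 2^-1%:E)%E ->
          ~ I [set s | exists2 y, M y & B s y]].
Proof.
move=> idI /(not_egorov_sets_null idI)[B [mB IB] [N [mN N01 N0 Nnull]]].
have Noo : (completed_lebesgue_measure N < +oo)%E.
  apply: (@le_lt_trans _ _ 1%E); last exact: ltry.
  by rewrite -(completed_lebesgue_measure01 R); apply: le_outer_measure.
have [|a [b [ab Nab]]] := dense_interval mN; first by rewrite N0.
have c0 : 0 < b - a by rewrite subr_gt0.
pose phi (x : R) := (b - a) * x + a.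
pose psi (x : R) := (b - a)^-1 * x + (- a / (b - a)).
have phiK x : phi (psi x) = x.
  by rewrite /phi /psi; field; rewrite gt_eqF.
exists (fun s => phi @^-1` (N `&` B s)); split.
- by move=> s; apply: measurable_affine => //; exact: measurableI.
- move=> y _; have [Ny|Ny] := pselect (N (phi y)).
    by apply: ideal_sub idI _ _ _ (IB _ (N01 _ Ny)) => s [].
  by apply: ideal_sub idI _ _ _ (ideal_finite idI (finite_set0 _)) => s [].
move=> M mM M01 M12 IM.
pose N' : set (lebesgueTypeR R) := phi @^-1` (N `&` `]a, b]).
have mab : measurable (`]a, b]%classic : set (lebesgueTypeR R)).
  exact: sub_caratheodory (measurable_itv _).
have mN' : measurable N' by apply: measurable_affine => //; exact: measurableI.
have N'01 : N' `<=` `[0, 1].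
  move=> x [_]; rewrite /= !in_itv/= /phi => /andP[].
  rewrite ltrDr pmulr_rgt0// => /ltW -> /=.
  by rewrite -lerBrDr -{2}[b - a]mulr1 ler_pM2l.
have N'12 : (2^-1%:E < completed_lebesgue_measure N')%E.
  by rewrite outer_measure_affine// lte_pdivlMl// -EFinM.
(* As [phi] inverts [psi], this preimage is the image of [M] and [N'] intersected under [phi]. *)
have : completed_lebesgue_measure (psi @^-1` (M `&` N')) = 0%E.
  apply: Nnull.
  - by apply: measurable_affine; rewrite ?invr_gt0//; exact: measurableI.
  - by move=> x [_ []]; rewrite phiK.
  apply: ideal_sub idI _ _ _ IM => s [y [My [Ny _]] By].
  by exists (psi y) => //; rewrite /= phiK in Ny *.
rewrite outer_measure_affine ?invr_gt0// invrK => /eqP.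
rewrite mule_eq0 eqe gt_eqF//= => /eqP MN0.
suff : (completed_lebesgue_measure N' <= 2^-1%:E)%E by rewrite leNgt N'12.
apply: (@le_trans _ _ (completed_lebesgue_measure (M `&` N') +
    completed_lebesgue_measure (`[0%R, 1%R] `\` M))%E); last first.
  by rewrite MN0 add0e ltW.
apply: le_trans (outer_measureU2 _ _ _); apply: le_outer_measure => x N'x.
by have [Mx|Mx] := pselect (M x); [left|right; split => //; exact: N'01].
Qed.

(** * Both directions for the ideal sum *)

Lemma ideal_sum_sub (J : set (set nat)) (I : nat -> set (set nat)) :
  ideal J -> (forall n, ideal (I n)) ->
  forall A B, A `<=` B -> ideal_sum J I B -> ideal_sum J I A.
Proof.
move=> idJ idI A B AB; apply: ideal_sub idJ _ _ _ => n /=.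
by apply: contra_not; apply: ideal_sub (idI n) _ _ _ => j; rewrite /xsection/= !inE; exact: AB.
Qed.

Theorem theorem6p12 (R : realType) (J : set (set nat))
    (I : nat -> set (set nat)) (idealJ : ideal J)
    (idealI : forall n, ideal (I n))
    (analyticI : forall n, analytic_family (I n)) :
  egorov R (ideal_sum J I) <->
  egorov R J /\ J [set n | ~ egorov R (I n)].
Proof.
have Jsub := ideal_sub idealJ.
have Isub n := ideal_sub (idealI n).
have Sub := ideal_sum_sub idealJ idealI.
split=> [eS|[eJ Jbad]].
  split.
    (* The sets [B p.1] ignore the second coordinate, so each section is empty or everything, and
       lies in [I n] exactly when it is empty. *)
    apply/(egorovP R Jsub) => B mB JB eta eta0.
    have [|y y01|M [mM M01 etaM JM]] :=
        (egorovP R Sub).1 eS (fun p => B p.1) _ _ eta eta0; first by [].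
      apply: Jsub (JB y y01) => n /=; apply: contra_notP => nB.
      apply: Isub (ideal_finite (idealI n) (finite_set0 _)) => j.
      by rewrite /xsection/= inE.
    exists M; split => //; apply: Jsub JM => n [y My By] /= In.
    apply: (ideal_proper (idealI n)); apply: Isub In => j _.
    by rewrite /xsection/= inE; exists y.
  (* Egorov ideals get empty sets, the others witnesses against 1/2; the one set [M] found for the
     sum then has every bad [n] in its exceptional set. *)
  have /choice[B BP] : forall n, exists B : nat -> set (lebesgueTypeR R),
      [/\ forall s, measurable (B s),
        forall y, `[0%R, 1%R]%classic y -> I n [set s | B s y] &
        ~ egorov R (I n) -> forall M : set (lebesgueTypeR R),
          measurable M -> M `<=` `[0, 1] ->
          (completed_lebesgue_measure (`[0%R, 1%R] `\` M) < 2^-1%:E)%E ->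
          ~ I n [set s | exists2 y, M y & B s y]].
    move=> n; have [eI|neI] := pselect (egorov R (I n)); last first.
      by have [B [mB IB BM]] := not_egorov_half (idealI n) neI; exists B.
    exists (fun=> set0); split => // y _.
    exact: Isub (ideal_finite (idealI n) (finite_set0 _)).
  have half0 : 0 < 2^-1 :> R by rewrite invr_gt0.
  have [[n j]|y y01|M [mM M01 M12 JM]] :=
      (egorovP R Sub).1 eS (fun p => B p.1 p.2) _ _ _ half0.
  - by have [] := BP n.
  - apply: Jsub (ideal_finite idealJ (finite_set0 _)) => n /=; apply.
    have [_ /(_ y y01) + _] := BP n; apply: Isub => j.
    by rewrite /xsection/= inE.
  apply: Jsub JM => n /= neI; have [_ _ /(_ neI M mM M01 M12)] := BP n.
  apply: contra_not; apply: Isub => j.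
  by rewrite /xsection/= inE.
apply/(egorovP R Sub) => B mB SB eta eta0.
pose L := lebesgueTypeR R.
pose C n : set L := `[0%R, 1%R]%classic `&` ~` [set y | I n [set j | B (n, j) y]].
have mI n : measurable
    (`[0%R, 1%R]%classic `&` [set y | I n [set j | B (n, j) y]] : set L).
  (* The condition depends on [y] only through its code in the Cantor space, so the analyticity of
     [I n] applies. *)
  have IE (y : R) : I n [set j | B (n, j) y] =
      (set_of_cantor @^-1` I n) (fun j => `[< B (n, j) y >]).
    by congr (I n _); apply/seteqP; split=> j /asboolP.
  have [I0|[f cf fI]] := analyticI n.
    rewrite (_ : _ `&` _ = set0)//; apply/seteqP; split => // y [_] /=.
    by rewrite IE I0.
  have oo : (completed_lebesgue_measure (`[0%R, 1%R] : set R) < +oo)%E.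
    by rewrite completed_lebesgue_measure01 ltry.
  have := measurable_analytic (@completed_lebesgue_measure_is_complete R)
    (lebesgue_measurable01 R) oo (fun j => mB (n, j)) cf.
  rewrite fI; congr measurable; congr (_ `&` _).
  by apply/funext => y; rewrite /mkset IE.
have mC n : measurable (C n).
  rewrite (_ : C n = `[0%R, 1%R]%classic `\`
      (`[0%R, 1%R]%classic `&` [set y | I n [set j | B (n, j) y]])).
    by apply: measurableD => //; exact: lebesgue_measurable01.
  by rewrite setDIr setDv set0U.
(* Index 0 carries the requirement for [J] and index [n.+1] the one for [I n], vacuous if [I n] is
   not Egorov. *)
pose P k (M : set L) := if k is n.+1 then
    egorov R (I n) -> I n [set j | exists2 y, M y & B (n, j) y /\ ~ C n y]
  else J [set n | exists2 y, M y & C n y].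
have [[|n] e e0|M [mM M01 etaM MP]] := @cosmall_bigcap R P _ eta eta0.
- apply: (egorovP R Jsub).1 e0 => // y y01.
  apply: Jsub (SB y y01) => n /= [_]; apply: contra_not; apply: Isub => j.
  by rewrite /xsection/= inE.
- have [eI|neI] := pselect (egorov R (I n)); last first.
    exists `[0%R, 1%R]%classic; split => //; first exact: lebesgue_measurable01.
    by rewrite setDv measure0 lte_fin.
  have [|y y01|M [mM M01 eM IM]] :=
      (egorovP R (Isub n)).1 eI (fun j => B (n, j) `\` C n) _ _ e e0.
  + by move=> j; exact: measurableD.
  + have [Cy|Cy] := pselect (C n y).
      by apply: Isub (ideal_finite (idealI n) (finite_set0 _)) => j [].
    have : I n [set j | B (n, j) y] by apply: contrapT => nI; apply: Cy.
    by apply: Isub => j [].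
  by exists M; split => // _.
exists (\bigcap_k M k); split => //.
(* For [n] outside both sets the intersection misses [C n], so on it removing [C n] from [B (n, j)]
   changes nothing. *)
apply: Jsub (ideal_setU idealJ Jbad (MP 0%N)) => n /= nI.
apply: contrapT => /not_orP[/contrapT eI nC]; apply: nI.
apply: Isub (MP n.+1 eI) => j; rewrite /xsection/= inE => -[y My By].
exists y; first exact: My.
by split => // Cy; apply: nC; exists y => //; exact: My.
Qed.
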